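(* Let $M=\begin{pmatrix} a & b\\ c & d\end{pmatrix}$ be a matrix with entries in $\mathbb{Z}$ and $ad-bc\neq 0$, let $h(x)=\frac{ax+b}{cx+d}$ be the associated Möbius transformation, and let $D=|\det(M)|=|ad-bc|$. Let $B_1,B_2$ be positive integers and let $x=[a_0;a_1,a_2,\cdots]$ be a real number (with infinite continued fraction expansion) such that $B_1\leq a_j\leq B_2$ for all sufficiently large $j$. Let $h(x)=[a_0^{\star};a_1^{\star},a_2^{\star},\cdots]$ be the continued fraction expansion of $h(x)$. Then for all sufficiently large $j$, $$a_j^{\star}\leq \left\lfloor\frac{D-1}{B_1}\right\rfloor +\left\lfloor D\, \frac{B_1B_2+\sqrt{B_1^2B_2^2+4B_1B_2}}{2B_1}\right\rfloor .$$
   Context: $[a_0;a_1,a_2,\cdots]$ denotes the infinite (regular) continued fraction $a_0+\cfrac{1}{a_1+\cfrac{1}{a_2+\cdots}}$ with $a_0\in\mathbb{Z}$ and $a_i$ a positive integer for every $i\geq 1$; $a_j$ is called the $j$th partial quotient. A real number has an infinite continued fraction expansion if and only if it is irrational. $\lfloor x\rfloor=\max\{j\in\mathbb{Z}: j\leq x\}$. *)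

(* Defs.v *)
From HB Require Import structures.
From mathcomp Require Import all_boot all_order all_algebra.
From mathcomp Require Import all_classical all_reals all_analysis.
Set Implicit Arguments.
Unset Strict Implicit.
Unset Printing Implicit Defensive.
Import Order.TTheory GRing.Theory Num.Theory.
Import numFieldNormedType.Exports.
Local Open Scope classical_set_scope.
Local Open Scope ring_scope.

(* The finite continued fraction [a 0; a 1, ..., a n]. *)
Fixpoint cf_convergent (R : realType) (a : nat -> int) (n : nat) : R :=
  if n is n'.+1 then
    (a 0%N)%:~R + (cf_convergent R (fun k => a k.+1) n')^-1
  else (a 0%N)%:~R.

(* x = [a 0; a 1, a 2, ...], the infinite continued fraction being the limit
   of its truncations; a 0 may be any integer. *)
Definition is_cf (R : realType) (x : R) (a : nat -> int) : Prop :=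
  (forall i, (0 < i)%N -> 0 < a i) /\ cf_convergent R a @ \oo --> x.

Definition moebius (R : realType) (M : 'M[int]_2) (x : R) : R :=
  ((M 0 0)%:~R * x + (M 0 1)%:~R) / ((M 1 0)%:~R * x + (M 1 1)%:~R).

(* Main.v *)
Require Import Defs.
From HB Require Import structures.
From mathcomp Require Import all_boot all_order all_algebra.
From mathcomp Require Import all_classical all_reals all_analysis.
From mathcomp Require Import ring lra zify.
Set Implicit Arguments.
Unset Strict Implicit.
Unset Printing Implicit Defensive.
Import Order.TTheory GRing.Theory Num.Theory.
Import numFieldNormedType.Exports.
Local Open Scope classical_set_scope.
Local Open Scope ring_scope.

(** The idea is to read each partial quotient of [h x] off one integer matrix
    of determinant [D] up to sign.

    Write [x_n] for the complete quotients of [x], so that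
    [x = P_n x_n] with [P_n] the matrix of two consecutive convergents, and
    likewise [h x = Q_j y_j].  Then [y_j = T x_n] for the integer matrix
    [T = Q_j^-1 M P_n], of determinant [D] or [- D].  For a given large [j] one
    chooses [n] by looking at the lower entries [L_n] of these matrices.
    They obey the recurrence of the continued fraction of [x], start with
    alternating signs, because consecutive convergents lie on opposite sides
    of [x], and cannot alternate for ever, because [|L_n|] would be an endless
    descent in the integers ([no_perpetual_alternation]).  Where alternation
    stops, one of two things happens.

    - The next entry has the sign of the previous one.  The pole of [T] is then
      a real number between 0 and the next partial quotient of [x], and [y_j]
      is less than [2 D] ([generic_step_bound]); the claimed bound is never
      below [2 D - 1] ([generic_floor_bound]).

    - The next entry is 0.  Then [T] is upper triangular, that is
      [delta y_j = alpha x_n + e] with [alpha delta = D].  If [delta = 1], then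
      [floor y_j = e + floor (D x_n)], and each summand is at most the
      corresponding floor in the bound; if [delta >= 2], then [y_j] is smaller
      by a factor that makes the second floor suffice
      ([triangular_floor_bound]).

    Both cases need one more inequality, which comes from the image of
    infinity.  The point [P_n^-1 oo] is [- beta] with [beta] a ratio of
    consecutive denominators of [x], hence between 0 and [1 / B1].  The point
    [Q_j^-1 (h oo)] is negative for large [j], because [h oo] differs from
    [h x] while two consecutive convergents of [h x] are both close to [h x].
    So [T] sends [- beta] to a negative number ([pairing_infinity]).
    Subtracting it from [y_j] turns the estimates into exact identities, and in
    the triangular case with [delta = 1] it gives [e < D beta <= D / B1],
    which is the source of the summand [floor ((D - 1) / B1)].

    Finally [x_n] is at most the purely periodic continued fraction
    [[B2; B1, B2, B1, ...]], whose value is the quadratic irrational of the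
    statement ([cf_tail_le_periodic]). *)

(** * Complete quotients *)

Lemma cf_convergent_bounds (R : realType) (a : nat -> int) (n : nat) :
  (forall i, (0 < i)%N -> 0 < a i) ->
  (a 0%N)%:~R <= cf_convergent R a n <= (a 0%N)%:~R + 1.
Proof.
elim: n a => [|n IHn] a a_gt0 /=; first by apply/andP; split; lra.
have /IHn/andP[tail_ge _] : forall i, (0 < i)%N -> 0 < a i.+1.
  by move=> i _; apply: a_gt0.
have a1_ge1 : 1 <= (a 1%N)%:~R :> R by rewrite ler1z -gtz0_ge1 a_gt0.
have tail_ge1 := le_trans a1_ge1 tail_ge.
have tail_gt0 := lt_le_trans ltr01 tail_ge1.
have := invf_le1 tail_gt0; rewrite tail_ge1 => inv_le1.
have inv_ge0 : 0 <= (cf_convergent R (fun k => a k.+1) n)^-1.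
  by rewrite invr_ge0 ltW.
by apply/andP; split; lra.
Qed.

(** The truncations of the tail lie in [[a 1, a 1 + 1]], so their inverses stay
    away from 0: this gives both the strict inequality and the continuity of
    inversion at the limit. *)
Lemma is_cf_gt_behead (R : realType) (x : R) (a : nat -> int) :
  is_cf x a ->
  (a 0%N)%:~R < x /\ is_cf (x - (a 0%N)%:~R)^-1 (fun k => a k.+1).
Proof.
case=> a_gt0 cvx.
have a'_gt0 i : (0 < i)%N -> 0 < a i.+1 by move=> _; apply: a_gt0.
have a1_ge1 : 1 <= (a 1%N)%:~R :> R by rewrite ler1z -gtz0_ge1 a_gt0.
pose c' := cf_convergent R (fun k => a k.+1).
have c'_ge1 n : 1 <= c' n.
  by have /andP[+ _] := cf_convergent_bounds R n a'_gt0; apply: le_trans.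
have c'_le n : c' n <= (a 1%N)%:~R + 1.
  by have /andP[] := cf_convergent_bounds R n a'_gt0.
have cv_inv : (c' n)^-1 @[n --> \oo] --> x - (a 0%N)%:~R.
  have : cf_convergent R a n.+1 @[n --> \oo] --> x.
    by move: cvx; rewrite -cvg_shiftS.
  move=> cvxS.
  have -> : (fun n => (c' n)^-1)
      = (fun n => cf_convergent R a n.+1 - (a 0%N)%:~R).
    by apply/funext => n /=; rewrite -/(c' n) addrC addKr.
  exact: cvgB cvxS (cvg_cst _).
have a1p : 0 < (a 1%N)%:~R + 1 :> R by lra.
have diff_ge : ((a 1%N)%:~R + 1)^-1 <= x - (a 0%N)%:~R.
  apply: (cvgr_to_ge cv_inv); near=> n.
  rewrite lef_pV2 ?posrE //; apply: lt_le_trans (c'_ge1 n); exact: ltr01.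
have diff_gt0 : 0 < x - (a 0%N)%:~R.
  by apply: lt_le_trans diff_ge; rewrite invr_gt0.
split; first by rewrite -subr_gt0.
split=> //.
have -> : cf_convergent R (fun k => a k.+1) = (fun n => (c' n)^-1^-1).
  by apply/funext => n; rewrite invrK.
exact: cvgV (lt0r_neq0 diff_gt0) cv_inv.
Unshelve. all: by end_near. Qed.

(** The complete quotients [x_n] of [x]: [x = [a 0; ..., a (n-1), x_n]]. *)
Fixpoint cf_tail (R : realType) (x : R) (a : nat -> int) (n : nat) : R :=
  if n is m.+1 then (cf_tail x a m - (a m)%:~R)^-1 else x.

Lemma cf_tailS (R : realType) (x : R) (a : nat -> int) (n : nat) :
  cf_tail x a n = (a n)%:~R + (cf_tail x a n.+1)^-1.
Proof. by rewrite /= invrK; ring. Qed.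

Lemma is_cf_tail (R : realType) (x : R) (a : nat -> int) (n : nat) :
  is_cf x a -> is_cf (cf_tail x a n) (fun k => a (n + k)%N).
Proof.
move=> cfx; elim: n => [//|n /is_cf_gt_behead[_]] /=.
rewrite addn0; congr is_cf; apply/funext => k; congr a; lia.
Qed.

Lemma cf_tail_gt (R : realType) (x : R) (a : nat -> int) (n : nat) :
  is_cf x a -> (a n)%:~R < cf_tail x a n.
Proof.
by move=> /(is_cf_tail n)/is_cf_gt_behead[]; rewrite addn0.
Qed.

Lemma cf_tail_gt1 (R : realType) (x : R) (a : nat -> int) (n : nat) :
  is_cf x a -> 1 < cf_tail x a n.+1.
Proof.
move=> cfx; apply: le_lt_trans (cf_tail_gt n.+1 cfx).
by rewrite ler1z -gtz0_ge1; apply: cfx.1.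
Qed.

(** * Convergents *)

(** The index is shifted by one from the usual one, so that the sequence begins
    with the formal convergent [1 / 0]: index [n.+1] belongs to
    [[a 0; ..., a n]]. *)
Fixpoint cf_num (a : nat -> int) (n : nat) : int :=
  match n with
  | 0 => 1
  | 1 => a 0%N
  | (m.+1 as k).+1 => a k * cf_num a k + cf_num a m
  end.

Fixpoint cf_den (a : nat -> int) (n : nat) : int :=
  match n with
  | 0 => 0
  | 1 => 1
  | (m.+1 as k).+1 => a k * cf_den a k + cf_den a m
  end.

Lemma cf_numSS (a : nat -> int) (n : nat) :
  cf_num a n.+2 = a n.+1 * cf_num a n.+1 + cf_num a n.
Proof. by []. Qed.

Lemma cf_denSS (a : nat -> int) (n : nat) :
  cf_den a n.+2 = a n.+1 * cf_den a n.+1 + cf_den a n.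
Proof. by []. Qed.

Lemma cf_det_unit (a : nat -> int) (n : nat) :
  (cf_num a n.+1 * cf_den a n - cf_num a n * cf_den a n.+1) ^+ 2 = 1.
Proof.
elim: n => [|n <-]; first by rewrite /= mulr0 mulr1 sub0r sqrrN expr1n.
by rewrite cf_numSS cf_denSS; ring.
Qed.

Lemma cf_den_bounds (a : nat -> int) (n : nat) :
  (forall i, (0 < i)%N -> 0 < a i) ->
  [/\ 0 <= cf_den a n, 1 <= cf_den a n.+1 & n%:Z <= cf_den a n.+1].
Proof.
move=> a_gt0.
suff [] : [/\ 0 <= cf_den a n, 1 <= cf_den a n.+1, n%:Z <= cf_den a n.+1
            & n = 0%N \/ 1 <= cf_den a n] by [].
elim: n => [|n [den_ge0 den1_ge1 den1_ge n0]]; first by split=> //; left.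
have a_pos := a_gt0 n.+1 isT.
split; rewrite ?cf_denSS.
- by lia.
- by nia.
- by nia.
- by right.
Qed.

(** If the signs alternate at [n] and [n.+1], the recurrence gives
    [|L n.+2| = |L n| - a n.+1 * |L n.+1| < |L n|]; so [|L n| + |L n.+1|]
    decreases as long as they alternate. *)
Lemma no_perpetual_alternation (a L : nat -> int) (N : nat) :
  (forall n, 0 < a n.+1) ->
  (forall n, L n.+2 = a n.+1 * L n.+1 + L n) ->
  L N * L N.+1 < 0 ->
  exists2 n, (N <= n)%N & L n * L n.+1 < 0 /\ 0 <= L n.+1 * L n.+2.
Proof.
move=> a_gt0 LS.
have [m] := ubnP (`|L N| + `|L N.+1|)%N.
elim: m N => // m IHm N ltm alt.
have [?|] := leP 0 (L N.+1 * L N.+2); first by exists N.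
move=> alt'; have := a_gt0 N; have := LS N => LSN aN.
have /IHm/(_ alt')[n leNn nP] : (`|L N.+1| + `|L N.+2| < m)%N.
  suff : `|L N.+2| < `|L N| by lia.
  move: alt alt'; rewrite LSN.
  move: (L N) (L N.+1) (a N.+1) aN => x y z z_gt0 xy_lt0 yz_lt0.
  nia.
by exists n => //; apply: leq_trans leNn.
Qed.

Definition cf_err (R : realType) (x : R) (a : nat -> int) (n : nat) : R :=
  (cf_num a n)%:~R - x * (cf_den a n)%:~R.

(** Equivalent to [x = (p_n x_n + p_(n-1)) / (q_n x_n + q_(n-1))], but free of
    divisions.  As complete quotients exceed 1, it shows at once that the errors
    alternate in sign and decrease in absolute value. *)
Lemma cf_err_tail (R : realType) (x : R) (a : nat -> int) (n : nat) :
  is_cf x a -> cf_err x a n = - cf_err x a n.+1 * cf_tail x a n.+1.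
Proof.
move=> cfx; have diff_gt0 m : 0 < cf_tail x a m - (a m)%:~R.
  by rewrite subr_gt0; apply: cf_tail_gt.
elim: n => [|n IHn].
  rewrite /cf_err /= mulr0 mulr1 subr0 -[x in - (_ - x)]/(cf_tail x a 0%N).
  by rewrite -[x in _ = _ * (x - _)^-1]/(cf_tail x a 0%N) opprB mulfV ?gt_eqF.
have -> : cf_err x a n.+2
    = (a n.+1)%:~R * cf_err x a n.+1 + cf_err x a n.
  by rewrite /cf_err cf_numSS cf_denSS !intrD !intrM; ring.
rewrite IHn -[cf_tail x a n.+2]/((cf_tail x a n.+1 - (a n.+1)%:~R)^-1).
by have /gt_eqF/negbT := diff_gt0 n.+1; move=> ?; field.
Qed.

Lemma cf_err_neq0 (R : realType) (x : R) (a : nat -> int) (n : nat) :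
  is_cf x a -> cf_err x a n != 0.
Proof.
move=> cfx; elim: n => [|n]; first by rewrite /cf_err /= mulr0 subr0 oner_eq0.
by rewrite (cf_err_tail n cfx); apply: contraNN => /eqP ->; rewrite oppr0 mul0r.
Qed.

Lemma cf_err_alternates (R : realType) (x : R) (a : nat -> int) (n : nat) :
  is_cf x a -> cf_err x a n * cf_err x a n.+1 < 0.
Proof.
move=> cfx; rewrite (cf_err_tail n cfx).
have := cf_err_neq0 n.+1 cfx; have := cf_tail_gt1 n cfx.
move: (cf_err _ _ _) (cf_tail _ _ _) => e t t1 e0.
have : 0 < e ^+ 2 by rewrite exprn_even_gt0.
nra.
Qed.

Lemma cf_err_le1 (R : realType) (x : R) (a : nat -> int) (n : nat) :
  is_cf x a -> `|cf_err x a n| <= 1.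
Proof.
move=> cfx; elim: n => [|n]; first by rewrite /cf_err /= mulr0 subr0 normr1.
rewrite (cf_err_tail n cfx) normrM normrN; have t1 := cf_tail_gt1 n cfx.
apply: le_trans; rewrite ler_peMr // ger0_norm; first exact: ltW.
exact: le_trans ler01 (ltW t1).
Qed.

(** If [c x + d = 0], then [c p_n + d q_n] is [c] times the error of the [n]-th
    convergent, so these integers would alternate in sign for ever. *)
Lemma is_cf_irrational (R : realType) (x : R) (a : nat -> int) (c d : int) :
  is_cf x a -> (c != 0) || (d != 0) -> c%:~R * x + d%:~R != 0.
Proof.
move=> cfx cd_neq0; apply/eqP => cxd0.
have dE : d%:~R = - c%:~R * x by lra.
have c_neq0 : c != 0.
  move: cd_neq0; apply: contraTneq => c0; rewrite c0 eqxx /=.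
  by move: dE; rewrite c0 oppr0 mul0r => /eqP; rewrite intr_eq0 => ->.
pose L n := c * cf_num a n + d * cf_den a n.
have LE n : (L n)%:~R = c%:~R * cf_err x a n.
  by rewrite /L /cf_err intrD !intrM dE; ring.
have alt n : L n * L n.+1 < 0.
  rewrite -(ltr_int R) intrM !LE mulrACA pmulr_rlt0 ?cf_err_alternates //.
  by rewrite -expr2 exprn_even_gt0 // intr_eq0.
have LS n : L n.+2 = a n.+1 * L n.+1 + L n.
  by rewrite /L cf_numSS cf_denSS; ring.
have a_gt0 n : 0 < a n.+1 by apply: cfx.1.
have [n _ [_]] := no_perpetual_alternation a_gt0 LS (alt 0%N).
by rewrite leNgt alt.
Qed.

(** Since [p_n / q_n] tends to [x], the numbers [q_n A - p_n C] take the sign of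
    [A - C x].  Quantitatively, [q_n A - p_n C = q_n (A - C x) - C e_n], where
    the error [e_n] is bounded by 1 and [q_n] is unbounded. *)
Lemma cf_form_sign (R : realType) (x : R) (a : nat -> int) (A C : int) :
  is_cf x a -> A%:~R - C%:~R * x != 0 ->
  \forall n \near \oo,
    0 < (cf_den a n * A - cf_num a n * C)%:~R * (A%:~R - C%:~R * x).
Proof.
move=> cfx; set e := A%:~R - _ => e_neq0.
exists (Num.bound (`|C%:~R| / `|e|)).+1 => //= -[//|n] /= le_bn.
have /archi_boundP : 0 <= `|C%:~R| / `|e| :> R by rewrite divr_ge0.
have e_gt0 : 0 < `|e| by rewrite normr_gt0.
rewrite ltr_pdivrMr // => ltC.
have [_ _] := cf_den_bounds n cfx.1.
rewrite -(ler_int R) => le_den.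
have le_b : (Num.bound (`|C%:~R| / `|e|))%:R <= n%:R :> R by rewrite ler_nat.
have den_gt : `|C%:~R| < (cf_den a n.+1)%:~R * `|e|.
  apply: (lt_le_trans ltC); rewrite ler_pM2r //.
  exact: le_trans le_b le_den.
have -> : (cf_den a n.+1 * A - cf_num a n.+1 * C)%:~R
    = (cf_den a n.+1)%:~R * e - C%:~R * cf_err x a n.+1.
  by rewrite intrD intrN !intrM /e /cf_err; ring.
have small : `|C%:~R * cf_err x a n.+1 * e| <= `|C%:~R| * `|e|.
  by rewrite !normrM ler_pM2r // ler_piMr // cf_err_le1.
have := ler_norm (C%:~R * cf_err x a n.+1 * e).
have := real_normK (num_real e).
have : `|C%:~R| * `|e| < (cf_den a n.+1)%:~R * `|e| * `|e| by rewrite ltr_pM2r.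
have -> : ((cf_den a n.+1)%:~R * e - C%:~R * cf_err x a n.+1) * e
    = (cf_den a n.+1)%:~R * e ^+ 2 - C%:~R * cf_err x a n.+1 * e by ring.
move=> lt1 <-; rewrite expr2 mulrA; lra.
Qed.

(** * The largest complete quotient *)

(** The value of the periodic continued fraction [[B2; B1, B2, B1, ...]]: the
    positive root of [B1 K^2 = B1 B2 K + B2], that is of
    [K = B2 + 1 / (B1 + 1 / K)]. *)
Definition cf_periodic (R : realType) (B1 B2 : nat) : R :=
  (B1%:R * B2%:R + Num.sqrt (B1%:R ^+ 2 * B2%:R ^+ 2 + 4 * B1%:R * B2%:R))
    / (2 * B1%:R).

Lemma cf_periodic_quadratic (R : realType) (B1 B2 : nat) :
  (0 < B1)%N ->
  let K := cf_periodic R B1 B2 in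
  B2%:R <= K /\ B1%:R * K ^+ 2 = B1%:R * B2%:R * K + B2%:R.
Proof.
move=> B1_gt0 K.
have b1 : 0 < B1%:R :> R by rewrite ltr0n.
have b2 : 0 <= B2%:R :> R by rewrite ler0n.
rewrite {}/K /cf_periodic; set b := B1%:R in b1 *; set c := B2%:R in b2 *.
have disc_ge0 : 0 <= b ^+ 2 * c ^+ 2 + 4 * b * c by nra.
have := sqrtr_ge0 (b ^+ 2 * c ^+ 2 + 4 * b * c).
have := sqr_sqrtr disc_ge0.
set S := Num.sqrt _ => S2 S_ge0; split.
  rewrite ler_pdivlMr; last by lra.
  suff : b * c <= S by lra.
  have [//|ltS] := leP (b * c) S.
  have : S ^+ 2 < (b * c) ^+ 2 by rewrite ltr_pXn2r ?nnegrE // mulr_ge0 // ltW.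
  rewrite S2 exprMn; nra.
have b_neq0 : b != 0 by rewrite gt_eqF.
have -> : b * ((b * c + S) / (2 * b)) ^+ 2
    = (b ^+ 2 * c ^+ 2 + 2 * b * c * S + S ^+ 2) / (4 * b) by field.
by rewrite S2; field.
Qed.

(** Expanding a complete quotient by two steps shows that an upper bound [U] of
    all of them may be replaced by [B2 + 1 / (B1 + 1 / U)].  For the supremum
    [U] this gives [U <= B2 + 1 / (B1 + 1 / U)], which forces [U <= K]. *)
Lemma cf_tail_le_periodic (R : realType) (x : R) (a : nat -> int)
    (B1 B2 N : nat) :
  (0 < B1)%N -> is_cf x a ->
  (forall k, (N <= k)%N -> B1%:Z <= a k <= B2%:Z) ->
  forall n, (N <= n)%N -> cf_tail x a n <= cf_periodic R B1 B2.
Proof.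
move=> B1_gt0 cfx a_bd n leNn.
have b1 : 1 <= B1%:R :> R by rewrite ler1n.
have b2 : 0 <= B2%:R :> R by rewrite ler0n.
have a_bdR k : (N <= k)%N -> B1%:R <= ((a k)%:~R : R) <= B2%:R.
  by move=> /a_bd; rewrite -2!(ler_int R).
have t_gt0 k : (N <= k)%N -> 0 < cf_tail x a k.
  move=> /a_bdR/andP[ak _]; have := cf_tail_gt k cfx; lra.
pose E := [set cf_tail x a k | k in [set k | (N <= k)%N]].
have E_neq0 : E !=set0 by exists (cf_tail x a n); exists n.
have improve U : ubound E U -> 0 < U /\ ubound E (B2%:R + (B1%:R + U^-1)^-1).
  move=> ubU.
  have leU k : (N <= k)%N -> cf_tail x a k <= U.
    by move=> Nk; apply: ubU; exists k.
  have U_gt0 : 0 < U := lt_le_trans (t_gt0 n leNn) (leU n leNn).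
  split=> // _ [k /= leNk <-].
  have [leNk1 leNk2] : (N <= k.+1)%N /\ (N <= k.+2)%N by lia.
  have /andP[_ ak] := a_bdR k leNk; have /andP[ak1 _] := a_bdR k.+1 leNk1.
  rewrite cf_tailS lerD // lef_pV2 ?posrE ?t_gt0 //; last first.
    by rewrite addr_gt0 ?invr_gt0 //; lra.
  by rewrite cf_tailS lerD // lef_pV2 ?posrE ?t_gt0 // leU.
have ubE : has_ubound E.
  exists (B2%:R + 1) => _ [k /= leNk <-].
  have leNk1 : (N <= k.+1)%N by lia.
  have /andP[_ ak] := a_bdR k leNk; rewrite cf_tailS lerD //.
  by rewrite invf_le1 ?t_gt0 // ltW // cf_tail_gt1.
have [U_gt0 /(ge_sup E_neq0)] := improve _ (ub_le_sup ubE).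
have : cf_tail x a n <= sup E by apply: ub_le_sup ubE _ _; exists n.
move: (sup E) U_gt0 => U U_gt0 tU leU; apply: le_trans tU _.
have [leBK KE] := cf_periodic_quadratic R B2 B1_gt0.
move: (cf_periodic R B1 B2) leBK KE => K leBK KE.
have : U * (B1%:R * U + 1) <= B2%:R * (B1%:R * U + 1) + U.
  have p_gt0 : 0 < B1%:R * U + 1 by nra.
  rewrite -ler_pdivlMr // mulrDl mulfK ?gt_eqF //.
  have U_neq0 : U != 0 by rewrite gt_eqF.
  suff <- : (B1%:R + U^-1)^-1 = U / (B1%:R * U + 1) by [].
  by field; rewrite U_neq0 /= gt_eqF.
have [//|ltKU] := leP U K => le2.
have : 0 < (U - K) * (B1%:R * (U + K) - B1%:R * B2%:R).
  by apply: mulr_gt0; [lra | nra].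
nra.
Qed.

(** * Integer matrices of a given determinant *)

(** Here [T z = - (A z + B) / (C z + E)] has determinant [D] up to sign,
    [y = T xi], and [T (- beta)] is negative.  Normalise signs so that
    [C > 0].  With [X = C xi + E] and [Z = beta C - E] one has
    [y - T (- beta) = (A E - B C) (xi + beta) / (X Z)
                   <= D (X + Z) / (X Z) = D (1 / X + 1 / Z)],
    and the sign pattern of the integers [C], [E] and [a C + E] makes
    [X > 1] and [Z >= 1]. *)
Lemma generic_step_bound (R : realFieldType) (A B C E a : int)
    (y xi beta : R) :
  0 <= beta -> a%:~R < xi -> C * E < 0 -> 0 < C * (a * C + E) ->
  y * (C%:~R * xi + E%:~R) = - (A%:~R * xi + B%:~R) ->
  0 < (beta * C%:~R - E%:~R) * (beta * A%:~R - B%:~R) ->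
  y < 2 * `|A * E - B * C|%:~R.
Proof.
move=> beta_ge0 lt_a_xi.
wlog C_gt0 : A B C E / 0 < C => [gen|].
  move=> CE aCE; have [/gen|C_lt0 yE bp|C0] := ltrgtP 0 C; first exact.
    have -> : A * E - B * C = - A * - E - - B * - C by ring.
    apply: gen; first by rewrite oppr_gt0.
    - by rewrite mulrNN.
    - by rewrite (_ : _ * _ = C * (a * C + E)) //; ring.
    - by rewrite !intrN; move: yE; lra.
    - by rewrite !intrN; move: bp; congr (_ < _); ring.
  by move: CE; rewrite -C0 mul0r ltxx.
rewrite pmulr_rlt0 // pmulr_rgt0 // => E_lt0 aCE yE.
have C_ge1 : 1 <= C%:~R :> R by rewrite ler1z.
have E_leN1 : E%:~R <= -1 :> R by rewrite -(intrN R 1) ler_int; lia.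
have : 1 <= (a * C + E)%:~R :> R by rewrite ler1z.
rewrite intrD intrM => aCE_ge1.
pose X := C%:~R * xi + E%:~R; pose Z := beta * C%:~R - E%:~R.
have X_gt1 : 1 < X by rewrite /X; nra.
have Z_ge1 : 1 <= Z by rewrite /Z; nra.
rewrite -/Z pmulr_rgt0; last by lra.
move=> W_gt0; set T := A * E - B * C.
have TE : T%:~R = A%:~R * E%:~R - B%:~R * C%:~R :> R.
  by rewrite /T intrD intrN !intrM.
have leT : T%:~R <= `|T|%:~R :> R by rewrite ler_int ler_norm.
have T_ge0 : 0 <= `|T|%:~R :> R by rewrite ler0z.
have key : y * X * Z + (beta * A%:~R - B%:~R) * X = T%:~R * (xi + beta).
  by rewrite {1}/X yE TE /X /Z; ring.
have xb_ge0 : 0 <= xi + beta by rewrite /X /Z in X_gt1 Z_ge1; nra.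
have xb_le : xi + beta <= X + Z by rewrite /X /Z; nra.
have XZ_le : X + Z <= 2 * (X * Z) by nra.
have XZ_gt0 : 0 < X * Z by nra.
have WX_gt0 : 0 < (beta * A%:~R - B%:~R) * X by nra.
have : y * (X * Z) < 2 * `|T|%:~R * (X * Z).
  have s1 : T%:~R * (xi + beta) <= `|T|%:~R * (xi + beta) by rewrite ler_wpM2r.
  have s2 : `|T|%:~R * (xi + beta) <= `|T|%:~R * (2 * (X * Z)).
    by rewrite ler_wpM2l // (le_trans xb_le).
  rewrite mulrA; lra.
by rewrite ltr_pM2r.
Qed.

(** The case [C = 0] of the same setting, brought to positive coefficients.  The
    sign of [alpha] comes from [y - T (- beta) > 0], this difference being
    [alpha / delta] times [xi + beta > 0]. *)
Lemma triangular_step_form (R : realFieldType) (A B E : int)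
    (y xi beta : R) :
  0 <= beta -> 0 < xi -> 0 < y -> E != 0 ->
  y * E%:~R = - (A%:~R * xi + B%:~R) ->
  0 < - E%:~R * (beta * A%:~R - B%:~R) ->
  exists alpha delta e : int,
    [/\ 0 < alpha, 0 < delta, alpha * delta = `|A * E|,
        y * delta%:~R = alpha%:~R * xi + e%:~R & e%:~R < alpha%:~R * beta].
Proof.
move=> beta_ge0 xi_gt0 y_gt0.
wlog E_lt0 : A B E / E < 0 => [gen|].
  move=> E_neq0; have [/gen/(_ E_neq0)|E_gt0 yE bp|E0] := ltrgtP E 0.
  - exact.
  - have [|||//|al [de [e]]] := gen (- A) (- B) (- E).
    + by rewrite oppr_lt0.
    + by rewrite oppr_eq0.
    + by rewrite !intrN; move: yE; lra.
    + by rewrite !intrN; move: bp; congr (_ < _); ring.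
    by rewrite mulrNN; exists al, de, e.
  - by rewrite E0 eqxx in E_neq0.
move=> _ yE; have NE_gt0 : 0 < - E%:~R :> R by rewrite oppr_gt0 ltrz0.
rewrite pmulr_rgt0 // subr_gt0 => ltB.
have A_gt0 : 0 < A.
  rewrite -(ltr0z R).
  have : 0 < y * - E%:~R by rewrite mulr_gt0.
  by rewrite mulrN yE; nra.
exists A, (- E), B; split=> //.
- by rewrite oppr_gt0.
- by rewrite normrM (gtr0_norm A_gt0) (ltr0_norm E_lt0).
- by rewrite intrN mulrN yE opprK.
- by rewrite mulrC.
Qed.

(** For [delta = 1] the integer [e] is less than [alpha / b], hence at most
    [(alpha - 1) / b], and [z - e <= alpha xi].  For [delta >= 2] one has
    [y < (alpha / delta) (xi + beta) <= (D / 4) (2 K)], well below [D K]. *)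
Lemma triangular_floor_bound (R : realType) (alpha delta e z : int) (b : nat)
    (y xi beta K : R) :
  0 < alpha -> 0 < delta -> (0 < b)%N ->
  y * delta%:~R = alpha%:~R * xi + e%:~R -> e%:~R < alpha%:~R * beta ->
  beta * b%:R <= 1 -> xi <= K -> 1 <= K -> z%:~R <= y ->
  z <= Num.floor (((alpha * delta)%:~R - 1) / b%:R : R)
         + Num.floor ((alpha * delta)%:~R * K).
Proof.
move=> al_gt0 de_gt0 b_gt0 yE lt_e beta_b le_xi K_ge1 le_zy.
set D : R := (alpha * delta)%:~R.
have b_ge1 : 1 <= b%:R :> R by rewrite ler1n.
have al_ge1 : 1 <= alpha%:~R :> R by rewrite ler1z.
have [de1|de_ge2] : delta = 1 \/ 2 <= delta by lia.
- have DE : D = alpha%:~R by rewrite /D de1 mulr1.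
  rewrite {}de1 mulr1 in yE.
  rewrite DE; have -> : z = e + (z - e) by ring.
  apply: lerD; rewrite floor_ge_int.
    rewrite ler_pdivlMr; last by lra.
    have : e%:~R * b%:R < alpha%:~R :> R by nra.
    rewrite -[b%:R]/(b%:Z%:~R) -intrM ltr_int => lt_eb.
    by rewrite -(intrB R alpha 1) ler_int; lia.
  by rewrite intrB; nra.
- have D1 : 1 <= D by rewrite /D ler1z; nia.
  have de2 : 2 <= delta%:~R :> R by rewrite (ler_int R 2).
  rewrite -[z]add0r lerD // floor_ge_int.
    by rewrite divr_ge0 //; lra.
  have DE : D = alpha%:~R * delta%:~R by rewrite /D intrM.
  have beta_le1 : beta <= 1 by nra.
  have : y * delta%:~R <= alpha%:~R * (2 * K) by rewrite yE; nra.
  have : alpha%:~R * (2 * K) <= D * K.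
    by rewrite mulrA ler_wpM2r ?DE ?ler_wpM2l //; lra.
  have DK_gt0 : 0 < D * K by nra.
  by nra.
Qed.

(** For [c >= 2] the second floor alone is at least [2 D].  For [b = c = 1] the
    floors are at least [D - 1] and [D]. *)
Lemma generic_floor_bound (R : realType) (D : int) (b c : nat) (K : R) :
  0 < D -> (0 < b)%N -> (b <= c)%N -> c%:R <= K ->
  2 * D - 1 <=
    Num.floor ((D%:~R - 1) / b%:R : R) + Num.floor (D%:~R * K).
Proof.
move=> D_gt0 b_gt0 le_bc le_cK.
have D_ge1 : 1 <= D%:~R :> R by rewrite ler1z.
have [c_ge2|c1] : (2 <= c)%N \/ c = 1%N by lia.
- have : 2 <= c%:R :> R by rewrite ler_nat.
  move=> c2; rewrite -[_ - 1]add0r lerD // floor_ge_int.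
    by rewrite divr_ge0 ?ler0n //; lra.
  by rewrite intrB intrM; nra.
- have -> : b = 1%N by lia.
  rewrite c1 in le_cK.
  have -> : 2 * D - 1 = (D - 1) + D by ring.
  apply: lerD; rewrite floor_ge_int; first by rewrite divr1 intrB.
  by nra.
Qed.

(** * The Moebius map between two continued fractions *)

Lemma det_mx2E (M : 'M[int]_2) :
  \det M = M 0 0 * M 1 1 - M 0 1 * M 1 0.
Proof.
rewrite (expand_det_row _ 0) !big_ord_recl big_ord0 addr0 /cofactor !det_mx11.
rewrite !mxE /= expr0 mul1r expr1.
have -> : lift 0 0 = 1 :> 'I_2 by apply/val_inj.
have -> : lift 1 0 = 0 :> 'I_2 by apply/val_inj.
by rewrite mulN1r mulrN.
Qed.

(** Up to sign, the lower entries of [Q_j^-1 M P_k] are [pairing j k.+1] and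
    [pairing j k], and its upper entries are [pairing j.-1 k.+1] and
    [pairing j.-1 k].  The pairing vanishes exactly when [M] sends the [k]-th
    convergent of [x] to the [j]-th convergent of its image. *)
Definition pairing (M : 'M[int]_2) (a astar : nat -> int) (j k : nat) : int :=
  cf_den astar j * (M 0 0 * cf_num a k + M 0 1 * cf_den a k)
  - cf_num astar j * (M 1 0 * cf_num a k + M 1 1 * cf_den a k).

Lemma pairingSS (M : 'M[int]_2) (a astar : nat -> int) (j k : nat) :
  pairing M a astar j k.+2
  = a k.+1 * pairing M a astar j k.+1 + pairing M a astar j k.
Proof. by rewrite /pairing cf_numSS cf_denSS; ring. Qed.

(** Multiplicativity of the determinant in [Q_j^-1 M P_k]. *)
Lemma norm_det_pairing (M : 'M[int]_2) (a astar : nat -> int) (j k : nat) :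
  `|pairing M a astar j k.+1 * pairing M a astar j.+1 k
    - pairing M a astar j k * pairing M a astar j.+1 k.+1| = `|\det M|.
Proof.
pose W b i := cf_num b i.+1 * cf_den b i - cf_num b i * cf_den b i.+1.
have W1 b i : `|W b i| = 1.
  have /eqP := cf_det_unit b i; rewrite -/(W b i) sqrf_eq1.
  by case/orP => /eqP ->; rewrite ?normrN normr1.
rewrite -[RHS]mul1r -(W1 a k) -[RHS]mul1r -(W1 astar j) -!normrM.
rewrite -[LHS]normrN det_mx2E.
by congr `|_|; rewrite /W /pairing; ring.
Qed.

(** The denominator cannot vanish, since [x] is irrational and the lower row of
    [M] is not 0. *)
Lemma moebius_denom_neq0 (R : realType) (M : 'M[int]_2) (x : R)
    (a : nat -> int) :
  \det M != 0 -> is_cf x a -> (M 1 0)%:~R * x + (M 1 1)%:~R != 0.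
Proof.
move=> detM cfx; apply: is_cf_irrational cfx _.
apply: contraNT detM; rewrite negb_or !negbK => /andP[/eqP c0 /eqP d0].
by rewrite det_mx2E c0 d0 !mulr0 subr0.
Qed.

(** The left side is the limit of [pairing j k] divided by the [j]-th
    denominator, as [j] grows; so for large [j] the pairings alternate in [k] as
    the errors of the convergents of [x] do. *)
Lemma pairing_limit (R : realType) (M : 'M[int]_2) (x : R) (a : nat -> int)
    (k : nat) :
  \det M != 0 -> is_cf x a ->
  (M 0 0 * cf_num a k + M 0 1 * cf_den a k)%:~R
    - (M 1 0 * cf_num a k + M 1 1 * cf_den a k)%:~R * moebius M x
  = (\det M)%:~R / ((M 1 0)%:~R * x + (M 1 1)%:~R) * cf_err x a k.
Proof.
move=> detM cfx; have := moebius_denom_neq0 detM cfx => den0.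
rewrite det_mx2E /moebius /cf_err !(intrD, intrN, intrM); field.
exact: den0.
Qed.

Lemma pairing_sign (R : realType) (M : 'M[int]_2) (x : R)
    (a astar : nat -> int) (k : nat) :
  \det M != 0 -> is_cf x a -> is_cf (moebius M x) astar ->
  \forall j \near \oo,
    0 < (pairing M a astar j k)%:~R
        * ((\det M)%:~R / ((M 1 0)%:~R * x + (M 1 1)%:~R) * cf_err x a k).
Proof.
move=> detM cfx cfy; rewrite -(pairing_limit k detM cfx).
apply: cf_form_sign cfy _; rewrite pairing_limit //.
rewrite !mulf_neq0 ?invr_eq0 ?intr_eq0 ?cf_err_neq0 //.
exact: moebius_denom_neq0 cfx.
Qed.

(** The relation [y_j = T x_k], cleared of denominators: both linear forms are
    multiples, by the same factor, of the errors of consecutive convergents of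
    [h x]. *)
Lemma pairing_tail (R : realType) (M : 'M[int]_2) (x : R)
    (a astar : nat -> int) (j k : nat) :
  \det M != 0 -> is_cf x a -> is_cf (moebius M x) astar ->
  let P j k : R := (pairing M a astar j k)%:~R in
  let xi := cf_tail x a k.+1 in
  cf_tail (moebius M x) astar j.+1 * (P j.+1 k.+1 * xi + P j.+1 k)
  = - (P j k.+1 * xi + P j k).
Proof.
move=> detM cfx cfy P xi; set Y := moebius M x; set y := cf_tail Y _ _.
set w := (cf_den a k.+1)%:~R * xi + (cf_den a k)%:~R.
have den0 := moebius_denom_neq0 detM cfx.
have bE : (M 0 1)%:~R = Y * ((M 1 0)%:~R * x + (M 1 1)%:~R) - (M 0 0)%:~R * x.
  by rewrite /Y /moebius divfK //; ring.
have numE : (cf_num a k)%:~R = x * w - (cf_num a k.+1)%:~R * xi.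
  have := cf_err_tail k cfx; rewrite -/xi /cf_err /w => E.
  have -> : (cf_num a k)%:~R
    = ((cf_num a k)%:~R - x * (cf_den a k)%:~R) + x * (cf_den a k)%:~R by ring.
  by rewrite E; ring.
have PE i : P i k.+1 * xi + P i k
    = - (w * ((M 1 0)%:~R * x + (M 1 1)%:~R) * cf_err Y astar i).
  rewrite /P /pairing !(intrD, intrN, intrM) bE numE /cf_err /w; ring.
rewrite !PE (cf_err_tail j cfy) -/y; ring.
Qed.

(** The point [- beta] is [P_k^-1 oo], and [oo] is the formal convergent of
    index 0.  So, up to a common factor 1 or [- 1] and a positive denominator,
    the two factors of the conclusion are [pairing j.+1 0] and [pairing j 0]. *)
Lemma pairing_infinity (R : realType) (M : 'M[int]_2) (a astar : nat -> int)
    (j k : nat) :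
  0 < cf_den a k.+1 ->
  0 < pairing M a astar j 0 * pairing M a astar j.+1 0 ->
  let P j k : R := (pairing M a astar j k)%:~R in
  let beta : R := (cf_den a k)%:~R / (cf_den a k.+1)%:~R in
  is_true (0 < (beta * P j.+1 k.+1 - P j.+1 k) * (beta * P j k.+1 - P j k)).
Proof.
move=> s_gt0 P0 P beta.
pose V i := cf_den a k * pairing M a astar i k.+1
          - cf_den a k.+1 * pairing M a astar i k.
have VE : V j.+1 * V j = pairing M a astar j 0 * pairing M a astar j.+1 0.
  rewrite -[RHS]mul1r -(cf_det_unit a k) /V /pairing /=; ring.
have sR : 0 < (cf_den a k.+1)%:~R :> R by rewrite ltr0z.
have bV i : beta * P i k.+1 - P i k = (V i)%:~R / (cf_den a k.+1)%:~R.
  rewrite /beta /P /V !(intrD, intrN, intrM); field.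
  by rewrite gt_eqF.
rewrite !bV mulf_div -intrM VE divr_gt0 ?ltr0z //; exact: mulr_gt0.
Qed.

Theorem theorem1p1 (R : realType) (M : 'M[int]_2) (hM : \det M != 0)
  (B1 B2 : nat) (hB1 : (0 < B1)%N) (hB2 : (0 < B2)%N)
  (x : R) (a : nat -> int) (hx : is_cf x a)
  (ha : \forall j \near \oo, B1%:Z <= a j <= B2%:Z)
  (astar : nat -> int) (hstar : is_cf (moebius M x) astar) :
  let D : R := `|\det M|%:~R in
  \forall j \near \oo,
    astar j <=
      Num.floor ((D - 1) / B1%:R) +
      Num.floor (D * ((B1%:R * B2%:R +
                       Num.sqrt (B1%:R ^+ 2 * B2%:R ^+ 2 + 4 * B1%:R * B2%:R))
                      / (2 * B1%:R))).
Proof.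
move=> D; rewrite -/(cf_periodic R B1 B2).
case: ha => N _ aN; pose K := cf_periodic R B1 B2.
pose P := pairing M a astar.
have le_B12 : (B1 <= B2)%N.
  by have /andP[/le_trans le1 /le1] := aN N (leqnn N); rewrite lez_nat.
have tail_leK := cf_tail_le_periodic hB1 hx aN.
have leB2K : B2%:R <= K by have [] := cf_periodic_quadratic R B2 hB1.
have K_ge1 : 1 <= K by apply: le_trans leB2K; rewrite ler1n.
have [J0 _ sgn0] := pairing_sign 0 hM hx hstar.
have [J1 _ sgnN] := pairing_sign N hM hx hstar.
have [J2 _ sgnN1] := pairing_sign N.+1 hM hx hstar.
exists (J0 + J1 + J2).+1 => // -[//|j] /= ltJj.
have P0 : 0 < P j 0 * P j.+1 0.
  have /sgn0 : (J0 <= j)%N by lia.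
  have /sgn0 : (J0 <= j.+1)%N by lia.
  rewrite -!/(P _ _) -(ltr0z R) intrM; set k := _ * cf_err _ _ _.
  move=> s1 s2; have := mulr_gt0 s2 s1.
  have k_neq0 : k != 0 by apply: contraTneq s1 => ->; rewrite mulr0 ltxx.
  by rewrite mulrACA -expr2 pmulr_lgt0 // exprn_even_gt0.
(* As [N] is beyond the exceptional partial quotients, so is the [n] found
   below. *)
have alt : P j.+1 N * P j.+1 N.+1 < 0.
  have /sgnN : (J1 <= j.+1)%N by lia.
  have /sgnN1 : (J2 <= j.+1)%N by lia.
  rewrite -!/(P _ _) -(ltrz0 R) intrM; set k := (_ / _) => s2 s1.
  have := mulr_gt0 s1 s2; rewrite mulrACA; set e := (X in 0 < _ * X) => pe.
  suff e_lt0 : e < 0 by rewrite (nmulr_lgt0 _ e_lt0) in pe.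
  have k_neq0 : k != 0.
    by apply: contraTneq s1 => ->; rewrite mul0r mulr0 ltxx.
  rewrite /e mulrACA -expr2 pmulr_rlt0 ?cf_err_alternates //.
  by rewrite exprn_even_gt0.
have a_gt0 n : 0 < a n.+1 by apply: hx.1.
have [n leNn [altn endn]] :=
  no_perpetual_alternation a_gt0 (pairingSS M a astar j.+1) alt.
rewrite -!/(P _ _) in altn endn.
have Pn1 : P j.+1 n.+1 != 0 by apply: contraTneq altn => ->; rewrite mulr0.
have den_gt0 k : 0 < cf_den a k.+1 by have [_] := cf_den_bounds k hx.1; lia.
set y := cf_tail (moebius M x) astar j.+1.
have ly : (astar j.+1)%:~R < y := cf_tail_gt j.+1 hstar.
have y_gt0 : 0 < y := lt_trans ltr01 (cf_tail_gt1 j hstar).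
have D_gt0 : 0 < `|\det M| by rewrite normr_gt0.
(* The sign change just found is used with the matrix one step further on when
   the next entry vanishes, so that its lower left entry is 0. *)
have [Pn2|Pn2] := eqVneq (P j.+1 n.+2) 0.
- have [den_ge0 _ _] := cf_den_bounds n.+1 hx.1.
  have beta_ge0 : 0 <= (cf_den a n.+1)%:~R / (cf_den a n.+2)%:~R :> R.
    by rewrite divr_ge0 ?ler0z // ltW.
  have xi_gt0 : 0 < cf_tail x a n.+2 := lt_trans ltr01 (cf_tail_gt1 n.+1 hx).
  have := pairing_infinity R (den_gt0 n.+1) P0.
  have := pairing_tail j n.+1 hM hx hstar.
  rewrite /= -!/(P _ _) -/y Pn2 mul0r add0r mulr0 sub0r => yE posE.
  have [al [de [e [al_gt0 de_gt0 alde yE' lt_e]]]] :=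
    triangular_step_form beta_ge0 xi_gt0 y_gt0 Pn1 yE posE.
  have -> : D = (al * de)%:~R.
    rewrite alde /D -(norm_det_pairing M a astar j n.+1) -!/(P _ _) Pn2.
    by rewrite mulr0 subr0.
  apply: triangular_floor_bound yE' lt_e _ (tail_leK n.+2 _) K_ge1 (ltW ly)
    => //.
    (* [cf_den a n.+2 >= a n.+1 * cf_den a n.+1 >= B1 * cf_den a n.+1] *)
    have s_gt0 : 0 < (cf_den a n.+2)%:~R :> R by rewrite ltr0z.
    rewrite mulrAC ler_pdivrMr // mul1r -[B1%:R]/(B1%:Z%:~R) -intrM ler_int.
    have /andP[a_ge _] : B1%:Z <= a n.+1 <= B2%:Z by apply: aN => /=; lia.
    have [den_n_ge0 _ _] := cf_den_bounds n hx.1.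
    by rewrite cf_denSS; nia.
  by lia.
- have beta_ge0 : 0 <= (cf_den a n)%:~R / (cf_den a n.+1)%:~R :> R.
    have [den0 _ _] := cf_den_bounds n hx.1.
    by rewrite divr_ge0 ?ler0z // ltW.
  have aP : 0 < P j.+1 n.+1 * (a n.+1 * P j.+1 n.+1 + P j.+1 n).
    by rewrite -pairingSS lt0r endn andbT mulf_neq0.
  have CE : P j.+1 n.+1 * P j.+1 n < 0 by rewrite mulrC.
  have := generic_step_bound beta_ge0 (cf_tail_gt n.+1 hx) CE aP
    (pairing_tail j n hM hx hstar) (pairing_infinity R (den_gt0 n) P0).
  rewrite norm_det_pairing -/y => lt_y.
  apply: le_trans (generic_floor_bound D_gt0 hB1 le_B12 leB2K).
  have : (astar j.+1)%:~R < (2 * `|\det M|)%:~R :> R.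
    by rewrite intrM; apply: lt_trans lt_y.
  by rewrite ltr_int; lia.
Qed.
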